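(* Let $k$ be an infinite field with $\operatorname{char}k\neq2$. Let $\mathbb{P}(V^1_{4,4,2,4,2,0})\cong\mathbb{P}^{21}$ be the parameter space of conic bundles of multidegree $(4,4,2,4,2,0)$ in $\mathcal{T}_{2,2,0}$, let $\mathcal{U}=\{a_3=a_4=c_2=0\}\subset\mathbb{P}(V^1_{4,4,2,4,2,0})$, and let $\mathcal{G}_{2,2,0}=\operatorname{Aut}(\mathcal{T}_{2,2,0})$. Then the map $$\chi:\mathcal{G}_{2,2,0}\times\mathcal{U}\longrightarrow\mathbb{P}(V^1_{4,4,2,4,2,0}),\qquad(\varphi,\mathcal{Q}^1)\mapsto\varphi^*\mathcal{Q}^1,$$ is dominant.
   Context: $\mathcal{T}_{2,2,0}=\mathbb{P}(\mathcal{O}_{\mathbb{P}^1}(2)\oplus\mathcal{O}_{\mathbb{P}^1}(2)\oplus\mathcal{O}_{\mathbb{P}^1})$ is the toric variety with Cox ring $k[x_0,x_1,y_0,y_1,y_2]$, $\deg x_i=(1,0)$, $\deg y_0=\deg y_1=(-2,1)$, $\deg y_2=(0,1)$, irrelevant ideal $(x_0,x_1)\cap(y_0,y_1,y_2)$. Points of $\mathbb{P}(V^1_{4,4,2,4,2,0})$ are conic bundles $\{\sigma_{0,0}y_0^2+\sigma_{0,1}y_0y_1+\sigma_{0,2}y_0y_2+\sigma_{1,1}y_1^2+\sigma_{1,2}y_1y_2+\sigma_{2,2}y_2^2=0\}\subset\mathcal{T}_{2,2,0}$ up to scaling, with coordinates given by the coefficients in $\sigma_{0,0}=\sum_{i=0}^4a_ix_0^{4-i}x_1^i$,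 $\sigma_{0,1}=\sum_{i=0}^4b_ix_0^{4-i}x_1^i$, $\sigma_{0,2}=\sum_{i=0}^2c_ix_0^{2-i}x_1^i$, $\sigma_{1,1}=\sum_{i=0}^4d_ix_0^{4-i}x_1^i$, $\sigma_{1,2}=\sum_{i=0}^2g_ix_0^{2-i}x_1^i$, $\sigma_{2,2}=h_0$. The automorphisms of $\mathcal{T}_{2,2,0}$ are: $x_0\mapsto\alpha_{0,0}x_0+\alpha_{0,1}x_1$, $x_1\mapsto\alpha_{1,0}x_0+\alpha_{1,1}x_1$, $y_0\mapsto\beta_{0,0}y_0+\beta_{0,1}y_1$, $y_1\mapsto\beta_{1,0}y_0+\beta_{1,1}y_1$, $y_2\mapsto\gamma_{2,2}y_2+\sum_{i=1}^3(\delta_{1,i}x_0^{3-i}x_1^{i-1}y_0+\theta_{1,i}x_0^{3-i}x_1^{i-1}y_1)$. *)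

(* Defs.v *)
From HB Require Import structures.
From mathcomp Require Import all_boot all_order all_algebra zify.
From mathcomp Require Import mpoly.

Set Implicit Arguments.
Unset Strict Implicit.
Unset Printing Implicit Defensive.

Import GRing.Theory.
Local Open Scope ring_scope.

Definition infinite_field (k : fieldType) : Prop :=
  forall s : seq k, exists x : k, x \notin s.

(* P^(N-1) over k, as the lines of k^N. *)
Record proj (k : fieldType) (N : nat) := Proj {
  line :> {vspace 'rV[k]_N};
  dim_line : \dim line == 1 }.

Section Zariski.

Variables (k : fieldType) (N : nat).

Definition vanishes_at (F : {mpoly k[N]}) (p : proj k N) : Prop :=
  forall v, v \in (p : {vspace _}) -> F.@[v 0] = 0.

Definition zariski_closed (Z : proj k N -> Prop) : Prop :=
  exists S : {mpoly k[N]} -> Prop,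
    (forall F, S F -> exists d : nat, F \is d.-homog) /\
    (forall p, Z p <-> forall F, S F -> vanishes_at F p).

Definition zariski_closure (A : proj k N -> Prop) (p : proj k N) : Prop :=
  forall Z, zariski_closed Z -> (forall q, A q -> Z q) -> Z p.

(* Density of the image of the k-points.  For infinite k and a source that is
   an open subvariety of a product of affine and projective spaces, the
   k-points of source and target are dense, so this is the same as
   scheme-theoretic dominance. *)
Definition dominant (X : Type) (f : X -> proj k N) : Prop :=
  forall p, zariski_closure (fun q => exists x, q = f x) p.

End Zariski.

Section ConicBundles.

Variable k : fieldType.

(* The Cox ring k[x0, x1, y0, y1, y2]. *)
Notation Cox := {mpoly k[5]}.
Notation x0 := ('X_0 : Cox).
Notation x1 := ('X_1 : Cox).
Notation y0 := ('X_2 : Cox).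
Notation y1 := ('X_3 : Cox).
Notation y2 := ('X_4 : Cox).

(* The coordinates of V are listed in the order
   a_0..a_4, b_0..b_4, c_0..c_2, d_0..d_4, g_0..g_2, h_0. *)
Notation V := 'rV[k]_22.

Definition coef_a (v : V) (i : nat) : k := v 0 (inord i).
Definition coef_b (v : V) (i : nat) : k := v 0 (inord (5 + i)%N).
Definition coef_c (v : V) (i : nat) : k := v 0 (inord (10 + i)%N).
Definition coef_d (v : V) (i : nat) : k := v 0 (inord (13 + i)%N).
Definition coef_g (v : V) (i : nat) : k := v 0 (inord (18 + i)%N).
Definition coef_h (v : V) : k := v 0 (inord 21).

Definition binary_form (d : nat) (c : nat -> k) : Cox :=
  \sum_(i < d.+1) c i *: (x0 ^+ (d - i) * x1 ^+ i).

Definition conic_eq (v : V) : Cox :=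
    binary_form 4 (coef_a v) * y0 ^+ 2
  + binary_form 4 (coef_b v) * (y0 * y1)
  + binary_form 2 (coef_c v) * (y0 * y2)
  + binary_form 4 (coef_d v) * y1 ^+ 2
  + binary_form 2 (coef_g v) * (y1 * y2)
  + coef_h v *: y2 ^+ 2.

(* The graded automorphisms of the Cox ring in their explicit form.  Every
   automorphism of T_{2,2,0} is induced by one of them; two of them inducing
   the same automorphism differ by the torus of the grading, which acts on V
   by scalars. *)
Record autT := AutT {
  alpha : 'M[k]_2;
  beta : 'M[k]_2;
  gamma : k;
  delta : 'rV[k]_3;
  theta : 'rV[k]_3;
  alpha_unit : alpha \in unitmx;
  beta_unit : beta \in unitmx;
  gamma_neq0 : gamma != 0 }.

(* Indices i = 0, 1, 2 stand for 1, 2, 3 in delta_{1,i} and theta_{1,i}. *)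
Definition aut_subst (f : autT) : 5.-tuple Cox :=
  [tuple alpha f 0 0 *: x0 + alpha f 0 1 *: x1;
         alpha f 1 0 *: x0 + alpha f 1 1 *: x1;
         beta f 0 0 *: y0 + beta f 0 1 *: y1;
         beta f 1 0 *: y0 + beta f 1 1 *: y1;
         gamma f *: y2 + \sum_(i < 3)
           (delta f 0 i *: (x0 ^+ (2 - i) * x1 ^+ i * y0)
            + theta f 0 i *: (x0 ^+ (2 - i) * x1 ^+ i * y1))].

Definition mon5 (a b c d e : nat) : 'X_{1..5} := [multinom [tuple a; b; c; d; e]].

(* The monomials of degree (0, 2) of the Cox ring, in the order of the
   coordinates of V. *)
Definition monoms : seq 'X_{1..5} :=
     [seq mon5 (4 - i) i 2 0 0 | i <- iota 0 5]
  ++ [seq mon5 (4 - i) i 1 1 0 | i <- iota 0 5]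
  ++ [seq mon5 (2 - i) i 1 0 1 | i <- iota 0 3]
  ++ [seq mon5 (4 - i) i 0 2 0 | i <- iota 0 5]
  ++ [seq mon5 (2 - i) i 0 1 1 | i <- iota 0 3]
  ++ [:: mon5 0 0 0 0 2].

Definition coords (p : Cox) : V := \row_(j < 22) p@_(nth 0%MM monoms j).

(* No coefficient is lost in coords: see conic_eq_pullback. *)
Definition pullback (f : autT) (v : V) : V := coords (conic_eq v \mPo aut_subst f).


Definition wt_x (m : 'X_{1..5}) : nat :=
  (m 0%R + m 1%R + 2 * m 4%R)%N.
Definition wt_y (m : 'X_{1..5}) : nat :=
  (m 2%R + m 3%R + m 4%R)%N.

Fact wt_x0 : wt_x 0%MM = 0%N. Proof. by rewrite /wt_x !mnm0E. Qed.
Fact wt_xD : {morph wt_x : m1 m2 / (m1 + m2)%MM >-> (m1 + m2)%N}.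
Proof. by move=> m1 m2; rewrite /wt_x !mnmDE; lia. Qed.
HB.instance Definition _ := isMeasure.Build 5 wt_x wt_x0 wt_xD.

Fact wt_y0 : wt_y 0%MM = 0%N. Proof. by rewrite /wt_y !mnm0E. Qed.
Fact wt_yD : {morph wt_y : m1 m2 / (m1 + m2)%MM >-> (m1 + m2)%N}.
Proof. by move=> m1 m2; rewrite /wt_y !mnmDE; lia. Qed.
HB.instance Definition _ := isMeasure.Build 5 wt_y wt_y0 wt_yD.

(* wt_x is the first degree plus twice the second one, and wt_y the second
   degree: this is degree (0, 2). *)
Definition conic_form (p : Cox) : bool :=
  (p \is ishomog1 4 wt_x) && (p \is ishomog1 2 wt_y).

Lemma comp_homog (mf : measure 5) (s : 5.-tuple Cox) d p :
  (forall i : 'I_5, tnth s i \is ishomog1 (mf U_(i)%MM) mf) ->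
  p \is ishomog1 d mf -> p \mPo s \is ishomog1 d mf.
Proof.
move=> hs /dhomogP hp; rewrite comp_mpolyE big_seq.
apply: rpred_sum => m /hp <-; apply: rpredZ.
rewrite (mfE mf m).
have := big_rec2 (fun (q : Cox) e => q \is ishomog1 e mf).
apply; first exact: dhomog1.
move=> i q e _ hq; apply: dhomogM => //.
rewrite mulnC; exact: dhomogMn.
Qed.

Lemma size_monoms : size monoms = 22%N. Proof. by []. Qed.

Lemma uniq_monoms : uniq monoms.
Proof. by rewrite -(map_inj_uniq (f := fun m : 'X_{1..5} => val (val m))) //;
  move=> m1 m2 /val_inj/val_inj. Qed.

Lemma mon5E (m : 'X_{1..5}) : m = mon5 (m 0) (m 1) (m 2) (m 3) (m 4).
Proof.
apply/mnmP => i; rewrite multinomE (tnth_nth 0%N).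
by case: i => [[|[|[|[|[|//]]]]] hi] /=; congr (m _); apply/val_inj.
Qed.

Lemma mem_monoms (m : 'X_{1..5}) : wt_x m = 4%N -> wt_y m = 2%N -> m \in monoms.
Proof.
rewrite {3}(mon5E m) /wt_x /wt_y.
move: (m 0) (m 1) (m 2) (m 3) (m 4) => a b c d e h1 h2.
rewrite -(mem_map (f := fun m : 'X_{1..5} => val (val m))); last
  by move=> m1 m2 /val_inj/val_inj.
have He : (e <= 2)%N by lia.
have Hd : (d <= 2 - e)%N by lia.
have -> : c = (2 - e - d)%N by lia.
have Hb : (b <= 4 - 2 * e)%N by lia.
have -> : a = (4 - 2 * e - b)%N by lia.
clear h1 h2.
by move: e d b He Hd Hb => [|[|[|//]]] [|[|[|//]]] // [|[|[|[|[|//]]]]].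
Qed.

Lemma mpolyX5 a b c d e : 'X_[mon5 a b c d e] =
  x0 ^+ a * x1 ^+ b * y0 ^+ c * y1 ^+ d * y2 ^+ e :> Cox.
Proof.
rewrite mpolyXE_id !big_ord_recr big_ord0 /= mul1r.
by do ![congr (_ * _)]; congr (_ ^+ _); rewrite ?multinomE //=; congr 'X_[U_(_)];
  apply: val_inj.
Qed.

Lemma binary_formE d (c : nat -> k) (r s t : nat) :
  binary_form d c * (y0 ^+ r * y1 ^+ s * y2 ^+ t) =
  \sum_(i < d.+1) c i *: 'X_[mon5 (d - i) i r s t].
Proof.
rewrite mulr_suml; apply: eq_bigr => i _.
by rewrite mpolyX5 -scalerAl !mulrA.
Qed.

Lemma conic_eqE v : conic_eq v = \sum_(j < 22) v 0 j *: 'X_[nth 0%MM monoms j].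
Proof.
rewrite (eq_bigr (fun j : 'I_22 => v 0 (inord j) *: 'X_[nth 0%MM monoms j]));
  last by move=> j _; rewrite inord_val.
rewrite -(big_mkord xpredT (fun j => v 0 (inord j) *: 'X_[nth 0%MM monoms j])).
rewrite (@big_cat_nat _ _ _ 21) // (@big_cat_nat _ _ _ 18 0 21) //.
rewrite (@big_cat_nat _ _ _ 13 0 18) // (@big_cat_nat _ _ _ 10 0 13) //.
rewrite (@big_cat_nat _ _ _ 5 0 10) //= big_nat1.
have E m n (r s t d : nat) : (forall i : 'I_(d.+1),
    nth 0%MM monoms (m + i) = mon5 (d - i) i r s t) -> (n - m)%N = d.+1 ->
  \sum_(m <= j < n) v 0 (inord j) *: 'X_[nth 0%MM monoms j] =
  binary_form d (fun i => v 0 (inord (m + i)%N)) * (y0 ^+ r * y1 ^+ s * y2 ^+ t).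
{ move=> h enm; rewrite binary_formE -{1}[m]add0n big_addn enm big_mkord.
  by apply: eq_bigr => i _; rewrite [(i + m)%N]addnC h. }
rewrite (E 0 5 2 0 0 4)%N //; last by case=> [[|[|[|[|[|i]]]]] hi].
rewrite (E 5 10 1 1 0 4)%N //; last by case=> [[|[|[|[|[|i]]]]] hi].
rewrite (E 10 13 1 0 1 2)%N //; last by case=> [[|[|[|i]]] hi].
rewrite (E 13 18 0 2 0 4)%N //; last by case=> [[|[|[|[|[|i]]]]] hi].
rewrite (E 18 21 0 1 1 2)%N //; last by case=> [[|[|[|i]]] hi].
by rewrite mpolyX5 !expr0 !expr1 !mul1r !mulr1.
Qed.

Lemma conic_formP p : conic_form p -> conic_eq (coords p) = p.
Proof.
case/andP => hx hy; apply/mpolyP => m.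
rewrite conic_eqE raddf_sum /=.
under eq_bigr => j _ do rewrite mcoeffZ mcoeffX mxE.
have [hm|hm] := boolP (m \in monoms).
  have lt : (index m monoms < 22)%N by rewrite -size_monoms index_mem.
  rewrite (bigD1 (Ordinal lt)) //= nth_index // eqxx mulr1 big1 ?addr0 //.
  move=> j ne; case: eqP => [e|]; last by rewrite mulr0.
  case/eqP: ne; apply/val_inj.
  by rewrite -[RHS]/(index m monoms) -e index_uniq ?uniq_monoms ?size_monoms.
rewrite big1 => [|j _]; last first.
  case: eqP => [e|]; last by rewrite mulr0.
  by rewrite -e mem_nth ?size_monoms in hm.
apply/esym/eqP; apply: contraNT hm; rewrite -mcoeff_msupp => hm.
by apply: mem_monoms; [exact: (dhomogP _ _ _ hx)|exact: (dhomogP _ _ _ hy)].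
Qed.

Lemma conic_eqK v : coords (conic_eq v) = v.
Proof.
apply/rowP => i; rewrite mxE conic_eqE raddf_sum /=.
under eq_bigr => j _ do rewrite mcoeffZ mcoeffX nth_uniq ?size_monoms ?uniq_monoms //.
rewrite (bigD1 i) //= eqxx mulr1 big1 ?addr0 // => j /negPf ne.
by rewrite -[(_ == _)%N]/(j == i) ne mulr0.
Qed.

Lemma conic_form_conic_eq v : conic_form (conic_eq v).
Proof.
rewrite conic_eqE; apply/andP; split; apply: rpred_sum => j _; apply: rpredZ;
  rewrite dhomogX; case: j; do 22?[case=> //].
Qed.

Lemma conic_eq_pullback f v :
  conic_eq (pullback f v) = conic_eq v \mPo aut_subst f.
Proof.
have hX (mf : measure 5) (i : 'I_5) : ('X_i : Cox) \is ishomog1 (mf U_(i)%MM) mf.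
  by rewrite dhomogX.
apply: conic_formP; have /andP[hx hy] := conic_form_conic_eq v.
have U i j : (U_(i) : 'X_{1..5})%MM j = (i == j) by rewrite mnm1E.
have h (mf : measure 5) : mf = wt_x :> (_ -> _) \/ mf = wt_y :> (_ -> _) ->
    forall i : 'I_5, tnth (aut_subst f) i \is ishomog1 (mf U_(i)%MM) mf.
  move=> hmf i; rewrite (tnth_nth 0).
  have e01 : mf U_(1%R)%MM = mf U_(0%R)%MM by case: hmf => ->; rewrite /wt_x /wt_y !U.
  have e23 : mf U_(3%R)%MM = mf U_(2%R)%MM by case: hmf => ->; rewrite /wt_x /wt_y !U.
  have e4 : mf U_(4%R)%MM = (mf U_(0%R)%MM * 2 + mf U_(2%R)%MM)%N
    by case: hmf => ->; rewrite /wt_x /wt_y !U.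
  have q (j : 'I_3) (y : Cox) : y \is ishomog1 (mf U_(2%R)%MM) mf ->
      x0 ^+ (2 - j) * x1 ^+ j * y \is ishomog1 (mf U_(4%R)%MM) mf.
    move=> hq; rewrite e4; apply: dhomogM => //.
    have -> : (mf U_(0%R)%MM * 2 = mf U_(0%R)%MM * (2 - j) + mf U_(0%R)%MM * j)%N.
      by rewrite -mulnDr subnK // -ltnS.
    by apply: dhomogM; apply: dhomogMn; first [exact: hX|rewrite -e01; exact: hX].
  have [E|[E|[E|[E|E]]]] : i = 0 \/ i = 1 \/ i = 2 \/ i = 3 \/ i = 4.
  - by case: i => [[|[|[|[|[|//]]]]] hi]; [left|right; left|right; right; left
      |do 3!right; left|do 4!right]; apply: val_inj.
  - by rewrite E /=; apply: rpredD; apply: rpredZ; first [exact: hX|rewrite -e01; exact: hX].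
  - by rewrite E /=; apply: rpredD; apply: rpredZ; first [exact: hX|rewrite e01; exact: hX].
  - by rewrite E /=; apply: rpredD; apply: rpredZ; first [exact: hX|rewrite -e23; exact: hX].
  - by rewrite E /=; apply: rpredD; apply: rpredZ; first [exact: hX|rewrite e23; exact: hX].
  rewrite E /=; apply: rpredD; first by apply: rpredZ; exact: hX.
  apply: rpred_sum => j _; apply: rpredD; apply: rpredZ; apply: q => //.
  by rewrite -e23.
by apply/andP; split; apply: comp_homog => // i; apply: h; [left|right].
Qed.

Lemma comp_comp_mpoly (p : Cox) (s t : 5.-tuple Cox) :
  (p \mPo s) \mPo t = p \mPo [tuple tnth s i \mPo t | i < 5].
Proof.
rewrite (comp_mpolyE p s) (comp_mpolyE p) raddf_sum /=; apply: eq_bigr => m _.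
rewrite comp_mpolyZ rmorph_prod; congr (_ *: _); apply: eq_bigr => i _.
by rewrite rmorphXn tnth_mktuple.
Qed.

Definition linear2 (M : 'M[k]_2) (u v : Cox) (i : 'I_2) : Cox :=
  M i 0 *: u + M i 1 *: v.

Lemma linear2K (M : 'M[k]_2) u v i : M \in unitmx ->
  linear2 M (linear2 (invmx M) u v 0) (linear2 (invmx M) u v 1) i =
  if i == 0 then u else v.
Proof.
move=> hM; have /matrixP E := mulmxV hM.
have := E i 0; have := E i 1; rewrite !mxE !big_ord_recl !big_ord0 !addr0.
rewrite (_ : lift ord0 ord0 = 1); last exact: val_inj.
rewrite -[ord0]/(0 : 'I_2) => E1 E0.
rewrite /linear2 !scalerDr !scalerA addrACA -!scalerDl E0 E1.
case: i {E0 E1} => [[|[|//]] hi] /=.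
  by rewrite scale0r scale1r addr0.
by rewrite scale0r scale1r add0r.
Qed.

Definition shear (f : autT) (a b c d : Cox) : Cox :=
  \sum_(i < 3) (delta f 0 i *: (a ^+ (2 - i) * b ^+ i * c)
                + theta f 0 i *: (a ^+ (2 - i) * b ^+ i * d)).

Definition aut_inv_subst (f : autT) : 5.-tuple Cox :=
  let t0 := linear2 (invmx (alpha f)) x0 x1 in
  let t2 := linear2 (invmx (beta f)) y0 y1 in
  [tuple t0 0; t0 1; t2 0; t2 1;
     (gamma f)^-1 *: (y2 - shear f (t0 0) (t0 1) (t2 0) (t2 1))].

Lemma aut_substK f (p : Cox) : (p \mPo aut_subst f) \mPo aut_inv_subst f = p.
Proof.
rewrite comp_comp_mpoly -[RHS]comp_mpoly_id; congr (_ \mPo _).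
apply: eq_from_tnth => i; rewrite !tnth_mktuple (tnth_nth 0).
have [E|[E|[E|[E|E]]]] : i = 0 \/ i = 1 \/ i = 2 \/ i = 3 \/ i = 4.
- by case: i => [[|[|[|[|[|//]]]]] hi]; [left|right; left|right; right; left
    |do 3!right; left|do 4!right]; apply: val_inj.
- rewrite E [nth _ _ _]/= raddfD /= !comp_mpolyZ !comp_mpolyXU.
  exact: (linear2K _ _ 0 (alpha_unit f)).
- rewrite E [nth _ _ _]/= raddfD /= !comp_mpolyZ !comp_mpolyXU.
  exact: (linear2K _ _ 1 (alpha_unit f)).
- rewrite E [nth _ _ _]/= raddfD /= !comp_mpolyZ !comp_mpolyXU.
  exact: (linear2K _ _ 0 (beta_unit f)).
- rewrite E [nth _ _ _]/= raddfD /= !comp_mpolyZ !comp_mpolyXU.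
  exact: (linear2K _ _ 1 (beta_unit f)).
rewrite E [nth _ _ _]/= raddfD /= comp_mpolyZ comp_mpolyXU /=.
rewrite scalerA mulfV ?gamma_neq0 // scale1r -[RHS](subrK (shear f
  (linear2 (invmx (alpha f)) x0 x1 0) (linear2 (invmx (alpha f)) x0 x1 1)
  (linear2 (invmx (beta f)) y0 y1 0) (linear2 (invmx (beta f)) y0 y1 1))).
congr (_ + _); rewrite raddf_sum; apply: eq_bigr => j _.
by rewrite raddfD /= !comp_mpolyZ !rmorphM !rmorphXn /= !comp_mpolyXU.
Qed.

Lemma pullback_is_linear f : linear (pullback f).
Proof.
move=> c u v; apply: (can_inj conic_eqK); rewrite conic_eq_pullback.
have L (a : k) (x y : V) : conic_eq (a *: x + y) = a *: conic_eq x + conic_eq y.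
  rewrite !conic_eqE scaler_sumr -big_split /=; apply: eq_bigr => j _.
  by rewrite !mxE scalerDl scalerA.
by rewrite !L raddfD /= comp_mpolyZ !conic_eq_pullback.
Qed.

HB.instance Definition _ f :=
  GRing.isLinear.Build k V V _ (pullback f) (pullback_is_linear f).

Lemma pullback_inj f : injective (pullback f).
Proof.
move=> u v /(congr1 (@conic_eq)); rewrite !conic_eq_pullback.
move=> /(congr1 (fun p => p \mPo aut_inv_subst f)); rewrite !aut_substK.
exact: (can_inj conic_eqK).
Qed.

Lemma dim_pullback f (Q : proj k 22) :
  \dim (linfun (pullback f) @: (Q : {vspace V}))%VS == 1.
Proof.
rewrite limg_dim_eq ?dim_line //; apply/eqP; rewrite -subv0.
apply/subvP => v; rewrite memv_cap memv_ker lfunE /= => /andP[_ /eqP h].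
by rewrite memv0; apply/eqP/(@pullback_inj f); rewrite h raddf0.
Qed.

(* The conic bundle f^* Q. *)
Definition pullback_point (f : autT) (Q : proj k 22) : proj k 22 :=
  Proj (dim_pullback f Q).

Definition inU (Q : proj k 22) : Prop :=
  forall v, v \in (Q : {vspace V}) ->
    coef_a v 3 = 0 /\ coef_a v 4 = 0 /\ coef_c v 2 = 0.

Definition chi (fQ : autT * {Q : proj k 22 | inU Q}) : proj k 22 :=
  pullback_point fQ.1 (sval fQ.2).

End ConicBundles.

Arguments chi : clear implicits.

(* Main.v *)
Require Import Defs.
From mathcomp Require Import all_boot all_order all_algebra ring.
From mathcomp Require Import mpoly.

(* The point u0 = x1^4 y0 y1 + x0 x1 y0 y2 lies in U, and the substitutions
   x0 -> x0 + p x1, y1 -> y1 + q y0, y2 -> y2 + r x1^2 y0 move it to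
   u0 + p c_2 + (q + p r) a_4 + r a_3, that is, exactly in the three directions
   missing from U.  Hence for every w in V there is a curve t -> u0 + t Z(t),
   polynomial in t, with Z(0) = w, whose points are pullbacks of points of U.
   A form F vanishing on the image of chi vanishes on these curves; the lowest
   homogeneous part of its Taylor expansion at u0 then vanishes at every w, and
   by induction on the degree F is zero on V. *)

Set Implicit Arguments.
Unset Strict Implicit.
Unset Printing Implicit Defensive.

Import GRing.Theory.
Local Open Scope ring_scope.

(** * Polynomials vanishing along curves through the origin *)

Section InfiniteField.

Variable k : fieldType.

Lemma infinite_field_uniq (n : nat) :
  infinite_field k -> exists2 s : seq k, uniq s & size s = n.
Proof.
move=> hinf; elim: n => [|n [s us ss]]; first by exists [::].
by have [x hx] := hinf s; exists (x :: s); rewrite /= ?hx ?ss.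
Qed.

Lemma horner_eq0 (p : {poly k}) :
  infinite_field k -> (forall t, p.[t] = 0) -> p = 0.
Proof.
move=> hinf hp; apply/eqP; apply: contraT => p0.
have [s us ss] := infinite_field_uniq (size p) hinf.
have := max_poly_roots p0 _ us; rewrite ss ltnn; apply.
by apply/allP => x _; rewrite rootE hp.
Qed.

Lemma horner_mmap (n : nat) (F : {mpoly k[n]}) (Z : 'I_n -> {poly k}) t :
  (mmap polyC Z F).[t] = F.@[fun i => (Z i).[t]].
Proof.
rewrite mevalE /mmap horner_sum; apply: eq_bigr => m _.
rewrite hornerM hornerC horner_prod; congr (_ * _).
by apply: eq_bigr => i _; rewrite horner_exp.
Qed.

Lemma meval_homog (n d : nat) (F : {mpoly k[n]}) (c : k) (v : 'I_n -> k) :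
  F \is d.-homog -> F.@[fun i => c * v i] = c ^+ d * F.@[v].
Proof.
move=> /dhomogP hF; rewrite !mevalE mulr_sumr !big_seq.
apply: eq_bigr => m /hF /= <-; rewrite mulrCA; congr (_ * _).
rewrite mdegE -prodrXr -big_split /=.
by apply: eq_bigr => i _; rewrite exprMn.
Qed.

(** The component [H i] of degree i contributes t^i H_i(Z(t)) along the curve. The sum vanishes for
    all t, hence identically since k is infinite; its lowest term gives H_j(w) = 0, by strong
    induction on j. *)
Lemma meval_eq0_curves (n : nat) (F : {mpoly k[n]}) :
  infinite_field k ->
  (forall w : 'I_n -> k, exists2 Z : 'I_n -> {poly k},
     forall i, (Z i).[0] = w i & forall t, F.@[fun i => t * (Z i).[t]] = 0) ->
  forall w, F.@[w] = 0.
Proof.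
move=> hinf hF.
pose H j := pihomog mdeg j F.
have FE : F = \sum_(j < msize F) H j by exact: (pihomog_partitionE (mf := mdeg)).
suff H0 j w : (H j).@[w] = 0.
  by move=> w; rewrite FE (raddf_sum (meval w)) big1 //= => j _; exact: H0.
elim/ltn_ind: j w => j IH w.
have [ltj|lej] := ltnP j (msize F); last first.
  rewrite /H pihomogE big_seq_cond big_pred0 ?meval0 // => m.
  apply/negP => /andP[/msize_mdeg_lt hm /eqP mj].
  by move: (leq_trans hm lej); rewrite mj ltnn.
have [Z Z0 hZ] := hF w.
pose K i := mmap polyC Z (H i).
(* This is F(t Z(t)) divided by t^j: components below j vanish by induction. *)
pose L := \sum_(i < msize F | (j <= i)%N) 'X^(i - j) * K i.
have L0 : 'X^j * L = 0.
  apply: horner_eq0 => // t; rewrite -(hZ t) FE (raddf_sum (meval _)) /=.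
  rewrite (bigID (fun i : 'I__ => j <= i)%N) /= [X in _ = _ + X]big1 ?addr0; last first.
    by move=> i; rewrite -ltnNge => /IH.
  rewrite hornerM hornerXn horner_sum mulr_sumr; apply: eq_bigr => i ji.
  rewrite (meval_homog _ _ (pihomogP _ _ _)) hornerM hornerXn horner_mmap.
  by rewrite mulrA -exprD subnKC.
(* Once t^j is cancelled, setting t = 0 leaves only the term i = j, which is H_j(Z(0)) = H_j(w). *)
have /eqP := L0; rewrite mulf_eq0 expf_eq0 polyX_eq0 andbF /= => /eqP/(congr1 (horner^~ 0)).
rewrite horner0 horner_sum (bigD1 (Ordinal ltj)) //= subnn expr0 mul1r.
rewrite horner_mmap (meval_eq _ Z0) big1 ?addr0 // => i /andP[ji ne].
rewrite hornerM hornerXn expr0n subn_eq0 leqNgt ltn_neqAle ji andbT.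
by rewrite eq_sym -[(_ == _)]/(i == Ordinal ltj) ne mul0r.
Qed.

End InfiniteField.

(** * A three-parameter family of unipotent substitutions *)

Section UnipotentFamily.

Variable k : fieldType.

Notation Cox := {mpoly k[5]}.
Notation V := 'rV[k]_22.

Lemma det_mx2 (M : 'M[k]_2) : \det M = M 0 0 * M 1 1 - M 0 1 * M 1 0.
Proof.
rewrite (expand_det_row _ 0) !big_ord_recl big_ord0 addr0 /cofactor.
rewrite !det_mx11 !mxE /= !addn0 expr0 !expr1 !mul1r mulN1r mulrN.
by congr (_ * M _ _ - M _ _ * M _ _); apply: val_inj.
Qed.

Lemma add1_delta_mx_unit (c : k) (i j : 'I_2) :
  i != j -> 1%:M + c *: delta_mx i j \in unitmx.
Proof.
move=> ij; rewrite unitmxE det_mx2 !mxE.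
case: i j ij => [[|[|//]] hi] [[|[|//]] hj] //= _;
by rewrite ?(mulr1n, mulr0n, mulr0, mul0r, addr0, add0r, mulr1, subr0, unitr1).
Qed.

(** The proof arguments determine [alpha] = 1 + p E_01, [beta] = 1 + q E_10 and [gamma] = 1. *)
Definition unipotent (p q r : k) : autT k :=
  AutT (r *: delta_mx 0 2) 0 (add1_delta_mx_unit p (isT : 0 != 1 :> 'I_2))
    (add1_delta_mx_unit q (isT : 1 != 0 :> 'I_2)) (oner_neq0 k).

Lemma unipotent_subst p q r : aut_subst (unipotent p q r) =
  [tuple 'X_0 + p *: 'X_1; 'X_1; 'X_2; q *: 'X_2 + 'X_3;
         'X_4 + r *: ('X_1 ^+ 2 * 'X_2)].
Proof.
apply: val_inj; rewrite /= !big_ord_recl big_ord0 !mxE /=.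
rewrite ?(mulr1n, mulr0n, mulr0, mul0r, addr0, add0r, mulr1, scale0r, scale1r).
by rewrite expr0 mul1r.
Qed.

Lemma unipotent_horner (p q r : {poly k}) :
  exists S : 'I_5 -> {poly Cox}, forall t i,
    tnth (aut_subst (unipotent p.[t] q.[t] r.[t])) i = (S i).[t%:MP].
Proof.
pose E (u : {poly k}) := map_poly (@mpolyC 5 k) u.
exists (tnth [tuple ('X_0 : Cox)%:P + E p * ('X_1)%:P; ('X_1)%:P; ('X_2)%:P;
  E q * ('X_2)%:P + ('X_3)%:P; ('X_4)%:P + E r * ('X_1 ^+ 2 * 'X_2)%:P]) => t i.
rewrite unipotent_subst !(tnth_nth 0).
have hE u x : u.[t] *: x = (E u * x%:P).[t%:MP].
  by rewrite hornerM horner_map hornerC mul_mpolyC.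
case: i => [[|[|[|[|[|//]]]]] hi] /=; by rewrite ?hornerD -?hE !hornerC.
Qed.

Lemma comp_mpoly_horner n m (p : {mpoly k[n]}) (s : n.-tuple {mpoly k[m]})
    (S : 'I_n -> {poly {mpoly k[m]}}) x :
  (forall i, tnth s i = (S i).[x]) ->
  p \mPo s = (mmap (polyC \o @mpolyC m k) S p).[x].
Proof.
move=> sS; rewrite comp_mpolyE /mmap horner_sum; apply: eq_bigr => j _.
rewrite hornerM hornerC horner_prod mul_mpolyC; congr (_ *: _).
by apply: eq_bigr => i _; rewrite horner_exp sS.
Qed.

Lemma mcoeff_horner n (P : {poly {mpoly k[n]}}) (m : 'X_{1..n}) t :
  P.[t%:MP]@_m = (\poly_(i < size P) (P`_i)@_m).[t].
Proof.
rewrite horner_poly horner_coef raddf_sum; apply: eq_bigr => i _ /=.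
by rewrite -rmorphXn mulrC mcoeffCM mulrC.
Qed.

(** Substituting polynomials in t over the Cox ring shows that the coordinates are polynomial in t;
    for general v no explicit formula is required. *)
Lemma pullback_horner (p q r : {poly k}) (v : V) :
  exists Z : 'I_22 -> {poly k}, forall t j,
    pullback (unipotent p.[t] q.[t] r.[t]) v 0 j = (Z j).[t].
Proof.
have [S hS] := unipotent_horner p q r.
pose P := mmap (polyC \o @mpolyC 5 k) S (conic_eq v).
exists (fun j => \poly_(i < size P) (P`_i)@_(nth 0%MM monoms j)) => t j.
by rewrite -mcoeff_horner mxE (comp_mpoly_horner _ (hS t)).
Qed.

Lemma pullback_unipotent0 (v : V) : pullback (unipotent 0 0 0) v = v.
Proof.
rewrite -[RHS]conic_eqK; congr coords; rewrite -[RHS]comp_mpoly_id.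
congr (_ \mPo _); rewrite unipotent_subst !scale0r !addr0 add0r.
apply: eq_from_tnth => i; rewrite tnth_mktuple (tnth_nth 0).
by case: i => [[|[|[|[|[|//]]]]] hi] /=; congr ('X_ _); apply: val_inj.
Qed.

Lemma conic_eqD : {morph @conic_eq k : u v / u + v}.
Proof.
move=> u v; rewrite !conic_eqE -big_split; apply: eq_bigr => j _ /=.
by rewrite mxE scalerDl.
Qed.

Lemma conic_eqZ c : {morph @conic_eq k : u / c *: u}.
Proof.
move=> u; rewrite !conic_eqE scaler_sumr; apply: eq_bigr => j _ /=.
by rewrite mxE scalerA.
Qed.

Definition unitv (j : nat) : V := delta_mx 0 (inord j).

Lemma conic_eq_unitv j : (j < 22)%N -> conic_eq (unitv j) = 'X_[nth 0%MM monoms j].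
Proof.
move=> hj; rewrite conic_eqE (bigD1 (inord j)) //= mxE !eqxx scale1r.
rewrite big1 ?addr0 ?inordK // => i /negPf ne.
by rewrite mxE ne andbF scale0r.
Qed.

(* Positions 9, 11, 12, 4, 3 are b_4, c_1, c_2, a_4, a_3. *)
Definition base_conic : V := unitv 9 + unitv 11.

(** The a_4 coefficient has two sources: q from x1^4 y0 y1, and p r from (x0 + p x1) x1 y0 (y2 + r
    x1^2 y0). *)
Lemma pullback_base_conic p q r : pullback (unipotent p q r) base_conic =
  base_conic + p *: unitv 12 + (q + p * r) *: unitv 4 + r *: unitv 3.
Proof.
apply: (can_inj (@conic_eqK k)); rewrite conic_eq_pullback unipotent_subst.
rewrite !conic_eqD !conic_eqZ !conic_eq_unitv //= !mpolyX5.
rewrite !(rmorphD, rmorphM, rmorphXn) /= !comp_mpolyXU /=.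
rewrite -!mul_mpolyC rmorphD rmorphM /=; ring.
Qed.

End UnipotentFamily.

(** * Curves of pullbacks through the base conic *)

Section Dominance.

Variable k : fieldType.

Notation V := 'rV[k]_22.

(** The counterpart of [inU] for vectors; it admits 0 and is stable under linear combinations. *)
Definition coordU (u : V) : Prop :=
  coef_a u 3 = 0 /\ coef_a u 4 = 0 /\ coef_c u 2 = 0.

Lemma base_conic_neq0 : base_conic k != 0.
Proof.
apply/eqP => /rowP/(_ (inord 9)).
by rewrite !mxE /= !eqE /= !inordK //= addr0 => /eqP; rewrite oner_eq0.
Qed.

Lemma coordU_base_conic : coordU (base_conic k).
Proof.
by rewrite /coordU /coef_a /coef_c !mxE /= !eqE /= !inordK //= !addr0.
Qed.

Lemma coordU_comb (c : k) (u v : V) : coordU u -> coordU v -> coordU (u + c *: v).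
Proof.
rewrite /coordU /coef_a /coef_c !mxE => -[-> [-> ->]] [-> [-> ->]].
by rewrite !mulr0 !addr0.
Qed.

Definition partU (w : V) : V :=
  w - (coef_c w 2 *: unitv k 12 + coef_a w 4 *: unitv k 4
       + coef_a w 3 *: unitv k 3).

Lemma coordU_partU w : coordU (partU w).
Proof.
rewrite /coordU /partU /coef_a /coef_c !mxE /= !eqE /= !inordK //=.
by rewrite !(mulr0, mulr1, addr0, add0r) !subrr.
Qed.

Lemma meval_pullback_eq0 (d : nat) (F : {mpoly k[22]}) f (u : V) :
  F \is d.-homog -> (forall x, vanishes_at F (chi k x)) -> coordU u ->
  F.@[pullback f u 0] = 0.
Proof.
move=> homF hF.
have nz (w : V) : w != 0 -> coordU w -> F.@[pullback f w 0] = 0.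
  move=> w0 [w3 [w4 w2]].
  have dQ : \dim <[w]>%VS == 1 by rewrite dim_vline w0.
  have hQ : inU (Proj dQ).
    move=> v /= /vlineP[c ->].
    by rewrite /coef_a /coef_c !mxE [w 0 _]w3 [w 0 _]w4 [w 0 _]w2 !mulr0.
  apply: (hF (f, exist _ (Proj dQ) hQ)) => /=.
  by rewrite -[pullback f w]lfunE memv_img ?memv_line.
have [-> _|] := eqVneq u 0; last exact: nz.
(* The zero vector spans no projective point. Here F(0) = 0^d F(v) with v the pullback of
   [base_conic], where F(v) = 0 is known; this also covers d = 0. *)
have := meval_homog 0 (pullback f (base_conic k) 0) homF.
rewrite nz ?base_conic_neq0 //; last exact: coordU_base_conic.
rewrite mulr0 => <-; apply: meval_eq => i.
by rewrite raddf0 mxE mul0r.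
Qed.

Lemma meval_homog_chi_eq0 (d : nat) (F : {mpoly k[22]}) (v : V) :
  infinite_field k -> F \is d.-homog ->
  (forall x, vanishes_at F (chi k x)) -> F.@[v 0] = 0.
Proof.
move=> hinf homF hF.
pose u0 := base_conic k.
pose H := F \mPo [tuple 'X_i + (u0 0 i)%:MP | i < 22].
have HE w : H.@[w] = F.@[fun i => w i + u0 0 i].
  rewrite comp_mpoly_meval; apply: meval_eq => i.
  by rewrite tnth_mktuple mevalD mevalXU mevalC.
suff H0 : forall w, H.@[w] = 0.
  rewrite -(H0 (fun i => v 0 i - u0 0 i)) HE.
  by apply: meval_eq => i; rewrite subrK.
apply: meval_eq0_curves => // w.
pose W : V := \row_j w j.
pose p : {poly k} := coef_c W 2 *: 'X.
pose r : {poly k} := coef_a W 3 *: 'X.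
(* Subtracting p r makes the a_4 coefficient q + p r linear in t. *)
pose q : {poly k} := coef_a W 4 *: 'X - p * r.
have [P hP] := pullback_horner p q r (partU W).
(* The constant part comes from moving [u0], and [P] from pulling back [partU W]; at t = 0 they add
   up to W. *)
pose Z i := (W 0 i - partU W 0 i)%:P + P i.
exists Z => [i|t].
  rewrite hornerD hornerC -hP /q /p /r !(hornerE, mulr0, oppr0).
  by rewrite pullback_unipotent0 subrK mxE.
rewrite HE -[RHS](meval_pullback_eq0 (unipotent p.[t] q.[t] r.[t]) homF hF
  (coordU_comb t coordU_base_conic (coordU_partU W))).
apply: meval_eq => i.
have combE (c : k) (a b : V) : (c *: a + b) 0 i = c * a 0 i + b 0 i by rewrite !mxE.
rewrite [_ + t *: _]addrC pullback_is_linear pullback_base_conic combE hP.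
rewrite /Z /partU !hornerE !mxE.
ring.
Qed.

End Dominance.

Theorem proposition4p5 (k : fieldType) (hinf : infinite_field k)
  (hchar : 2%N \notin [pchar k]%R) :
  dominant (chi k).
Proof.
(* Each equation of a closed set containing the image vanishes on all of V, so the set contains
   every point. *)
move=> p Z [S [homS ZS]] hZ; apply/ZS => F SF v _.
have [d homF] := homS _ SF.
apply: meval_homog_chi_eq0 homF _ => // x.
by have /ZS := hZ _ (ex_intro _ x erefl); apply.
Qed.
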